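(* Let $G$ and $G'$ be two groups given by finite presentations, and assume that $G \cong G(\Delta)$ and $G' \cong G(\Delta')$ for some finite simple graphs $\Delta$ and $\Delta'$. Then there exists an algorithm which, given the finite presentations of $G$ and $G'$, decides whether $G$ and $G'$ are isomorphic. The graphs $\Delta$ and $\Delta'$ need not be specified.
   Context: For a finite simple graph $\Delta$ (no loops or multiple edges), the right-angled Artin group $G(\Delta)$ is the group generated by the vertices of $\Delta$, subject only to the relations that two generators commute whenever the corresponding vertices are joined by an edge. The algorithm is a promise algorithm: it takes as input two finite presentations, is only required to behave correctly when both present right-angled Artin groups, and a single algorithm is to work uniformly for all such inputs. *)

(* Defs.v *)
From HB Require Import structures.
From mathcomp Require Import all_boot boolp.

Set Implicit Arguments.
Unset Strict Implicit.
Unset Printing Implicit Defensive.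

Local Open Scope quotient_scope.

(* The letter (x, false) stands for x, and (x, true) for its inverse. *)
Definition word (X : Type) := seq (X * bool).

Definition invw (X : Type) (w : word X) : word X :=
  rev [seq (a.1, ~~ a.2) | a <- w].

(* The congruence on words whose quotient is < X | R >: the monoid congruence
   generated by x x^-1 ~ 1, x^-1 x ~ 1 and r ~ 1 for the relators r. *)
Inductive cong (X : Type) (R : word X -> Prop) : word X -> word X -> Prop :=
| cong_refl w : cong R w w
| cong_sym w1 w2 : cong R w1 w2 -> cong R w2 w1
| cong_trans w1 w2 w3 : cong R w1 w2 -> cong R w2 w3 -> cong R w1 w3
| cong_cat w1 w2 w3 w4 :
    cong R w1 w2 -> cong R w3 w4 -> cong R (w1 ++ w3) (w2 ++ w4)
| cong_cancel x b : cong R [:: (x, b); (x, ~~ b)] [::]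
| cong_relator r : R r -> cong R r [::].

Section Presented.
Variables (X : choiceType) (R : word X -> Prop).

Definition congb : rel (word X) := fun u v => `[< cong R u v >].

Lemma congb_refl : reflexive congb.
Proof. by move=> w; apply/asboolP/cong_refl. Qed.

Lemma congb_sym : symmetric congb.
Proof. by move=> u v; apply/asboolP/asboolP; apply: cong_sym. Qed.

Lemma congb_trans : transitive congb.
Proof.
by move=> v u w /asboolP uv /asboolP vw; apply/asboolP; apply: cong_trans uv vw.
Qed.

Canonical congb_equiv := EquivRel congb congb_refl congb_sym congb_trans.

Definition presented := {eq_quot congb_equiv}.
HB.instance Definition _ := Choice.on presented.
HB.instance Definition _ := EqQuotient.on presented.

Definition pword (w : word X) : presented := \pi_presented w.

Lemma pwordP u v : pword u = pword v <-> cong R u v.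
Proof. by split=> [/eqquotP/asboolP | uv]; last exact/eqquotP/asboolP. Qed.

Lemma pword_repr (p : presented) : pword (repr p) = p.
Proof. exact: reprK. Qed.

Lemma cong_invl w : cong R (invw w ++ w) [::].
Proof.
rewrite /invw; elim: w => [|[x b] w IH] /=; first exact: cong_refl.
rewrite rev_cons cat_rcons; apply: cong_trans IH.
apply: cong_cat; first exact: cong_refl.
rewrite -[X in cong _ _ X]cat0s -cat1s -[(x, b) :: w]cat1s catA.
apply: cong_cat; last exact: cong_refl.
by have := cong_cancel R x (~~ b); rewrite negbK.
Qed.

Lemma invwK : involutive (@invw X).
Proof.
move=> w; rewrite /invw map_rev revK -map_comp -[RHS]map_id.
by apply: eq_map => -[x b] /=; rewrite negbK.
Qed.

Lemma cong_invr w : cong R (w ++ invw w) [::].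
Proof. by have := cong_invl (invw w); rewrite invwK. Qed.

Lemma cong_inv u v : cong R u v -> cong R (invw u) (invw v).
Proof.
move=> uv; apply: (@cong_trans _ _ _ (invw u ++ (v ++ invw v))).
  rewrite -[X in cong _ X _]cats0; apply: cong_cat; first exact: cong_refl.
  exact/cong_sym/cong_invr.
rewrite catA -[X in cong _ _ X]cat0s; apply: cong_cat; last exact: cong_refl.
apply: cong_trans (cong_invl u).
by apply: cong_cat; [exact: cong_refl | exact: cong_sym].
Qed.

Definition pone : presented := pword [::].
Definition pmul (p q : presented) : presented := pword (repr p ++ repr q).
Definition pinv (p : presented) : presented := pword (invw (repr p)).

Lemma pword_cat u v : pword (u ++ v) = pmul (pword u) (pword v).
Proof. by apply/pwordP/cong_cat; apply/pwordP; rewrite pword_repr. Qed.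

Lemma pword_inv u : pword (invw u) = pinv (pword u).
Proof. by apply/pwordP/cong_inv/pwordP; rewrite pword_repr. Qed.

Lemma pmulA : associative pmul.
Proof.
move=> p q r; rewrite -(pword_repr p) -(pword_repr q) -(pword_repr r).
by rewrite -!pword_cat catA.
Qed.

Lemma pmul1 : left_id pone pmul.
Proof. by move=> p; rewrite -(pword_repr p) -pword_cat. Qed.

Lemma pmulr1 : right_id pone pmul.
Proof. by move=> p; rewrite -(pword_repr p) -pword_cat cats0. Qed.

Lemma pmulV : left_inverse pone pinv pmul.
Proof.
move=> p; rewrite -(pword_repr p) -pword_inv -pword_cat.
exact/pwordP/cong_invl.
Qed.

Lemma pmulrV : right_inverse pone pinv pmul.
Proof.
move=> p; rewrite -(pword_repr p) -pword_inv -pword_cat.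
exact/pwordP/cong_invr.
Qed.

HB.instance Definition _ :=
  isGroup.Build presented pmulA pmul1 pmulr1 pmulV pmulrV.

End Presented.

Definition isomorphic (G H : groupType) : Prop :=
  exists f : {multiplicative G -> H}, bijective f.

Record finpres := FinPres {
  ngens : nat;
  relators : seq (word 'I_ngens)
}.

Definition fpgroup (P : finpres) : groupType :=
  presented (fun w : word 'I_(ngens P) => w \in relators P).

Record sgraph := SGraph {
  vertex : finType;
  adj : rel vertex;
  adj_sym : symmetric adj;
  adj_irr : irreflexive adj
}.

Definition raag (D : sgraph) : groupType :=
  presented (fun w : word (vertex D) => exists u v : vertex D,
    adj u v /\ w = [:: (u, false); (v, false); (u, true); (v, true)]).

(* Kleene's partial recursive functions of n arguments. *)
Inductive recfun : nat -> Type :=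
| RZero n : recfun n
| RSucc : recfun 1
| RProj n (i : 'I_n) : recfun n
| RComp k n (f : recfun k) (g : 'I_k -> recfun n) : recfun n
| RPrec n (f : recfun n) (g : recfun n.+2) : recfun n.+1
| RMu n (f : recfun n.+1) : recfun n.

(* computes F v y: F is defined at v, with value y.
   RPrec f g at (0, v) is f v; at (k + 1, v) it is g (k, value at (k, v), v).
   RMu f at v is the least y with f (y, v) = 0, where moreover f (k, v) must
   be defined for all k < y. *)
Fixpoint computes (n : nat) (F : recfun n) : n.-tuple nat -> nat -> Prop :=
  match F in recfun n return n.-tuple nat -> nat -> Prop with
  | RZero n => fun _ y => y = 0
  | RSucc => fun v y => y = (thead v).+1
  | RProj n i => fun v y => y = tnth v i
  | RComp k n f g => fun v y =>
      exists w : k.-tuple nat,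
        (forall i, computes (g i) v (tnth w i)) /\ computes f w y
  | RPrec n f g => fun v =>
      let u := [tuple of behead v] in
      (fix iter (k : nat) : nat -> Prop :=
         match k with
         | 0 => computes f u
         | k'.+1 => fun y =>
             exists z, iter k' z /\ computes g [tuple of k' :: z :: u] y
         end) (thead v)
  | RMu n f => fun v y =>
      computes f [tuple of y :: v] 0 /\
      forall k, k < y -> exists m, computes f [tuple of k :: v] m.+1
  end.

Lemma computes_fun n (F : recfun n) v y z :
  computes F v y -> computes F v z -> y = z.
Proof.
elim: n / F v y z => [n||n i|k n f IHf g IHg|n f IHf g IHg|n f IHf] v y z /=.
- by move=> -> ->.
- by move=> -> ->.
- by move=> -> ->.
- move=> [w1 [gw1 fw1]] [w2 [gw2 fw2]]; suff E : w1 = w2.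
    by apply: (IHf w2) => //; rewrite -E.
  by apply: eq_from_tnth => i; apply: IHg (gw1 i) (gw2 i).
- elim: (thead v) y z => [|k IHk] y z; first exact: IHf.
  move=> [y' [iy gy]] [z' [iz gz]]; rewrite (IHk _ _ iy iz) in gy.
  exact: IHg gy gz.
- move=> [fy Hy] [fz Hz]; case: (ltngtP y z) => // ltyz.
    by have [m fm] := Hz _ ltyz; have := IHf _ _ _ fy fm.
  by have [m fm] := Hy _ ltyz; have := IHf _ _ _ fz fm.
Qed.

(* Goedel numbers, through the bijection CodeSeq.code from seq nat to nat:
   x_i and x_i^-1 are the letters 2i and 2i + 1, and a presentation is the
   list of its number of generators followed by the codes of its relators. *)
Definition word_code n (w : word 'I_n) : nat :=
  CodeSeq.code [seq a.2 + (a.1 : nat).*2 | a : 'I_n * bool <- w].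

Definition pres_code (P : finpres) : nat :=
  CodeSeq.code (ngens P :: [seq word_code r | r <- relators P]).

(* Main.v *)
(* Over the field F_2, two classes a, b in H^1(G) = Hom(G, F_2) have zero cup
   product exactly when (a, b) lifts to a homomorphism from G to the Heisenberg
   group, so from a finite presentation one can compute the finite vector space
   H^1(G) with the relation "a cup b = 0".  For a right-angled Artin group this
   relation says that a_u b_v = a_v b_u for all edges uv, and it determines the
   graph: the cardinal of the centralizer of x is at most 2^(1 + d(w)) for every
   w in the support of x, where d is the degree in the complementary graph, with
   equality if x is the basis vector of w.  A linear isomorphism that respects
   the relation therefore respects the filtration by degrees, and a nonzero term
   in its determinant is a bijection of the vertices preserving adjacency:
   otherwise the images of two basis vectors of the same degree would agree up
   to terms of higher degree.
   Hence two right-angled Artin groups are isomorphic if and only if there is a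
   linear bijection between the classes that respects the relation, and this is
   a bounded search. *)

Require Import Defs.
From HB Require Import structures.
From mathcomp Require Import all_boot perm all_algebra boolp ring.

Set Implicit Arguments.
Unset Strict Implicit.
Unset Printing Implicit Defensive.

Import GRing.Theory.

(** * Closure properties of the recursive functions *)

(* The environment e is infinite, but f reads only an initial segment of it; any
   sufficiently large arity is allowed so that arities need not be matched. *)
Definition cmp (f : (nat -> nat) -> nat) : Prop :=
  exists N, forall n, N <= n -> exists F : recfun n,
    forall e : nat -> nat, computes F [tuple e i | i < n] (f e).

Lemma cmp_ext f g : f =1 g -> cmp f -> cmp g.
Proof.
move=> fg [N HN]; exists N => n /HN[F HF]; exists F => e.
by rewrite -fg.
Qed.

Lemma cmp_var i : cmp (fun e => e i).
Proof.
exists i.+1 => n ltin; exists (RProj (Ordinal ltin)) => e /=.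
by rewrite tnth_mktuple.
Qed.

(** Infinitely many functions are substituted, but [f] is computed from the first [N] entries, so
    the new arity has to dominate only the thresholds of finitely many [g i]. *)
Lemma cmp_subst f (g : nat -> (nat -> nat) -> nat) :
  cmp f -> (forall i, cmp (g i)) -> cmp (fun e => f (fun i => g i e)).
Proof.
move=> [N /(_ N (leqnn N))[F HF]] /choice[M HM].
exists (\max_(i < N) M i) => n leMn.
have /choice[G HG] (i : 'I_N) : exists G : recfun n,
    forall e : nat -> nat, computes G [tuple e i | i < n] (g i e).
  by apply: HM; apply: leq_trans leMn; exact: leq_bigmax.
exists (RComp F G) => e /=; exists [tuple g i e | i < N]; split=> [i|].
  by rewrite tnth_mktuple.
exact: HF (fun i => g i e).
Qed.

Lemma cmp_shift1 f : cmp f -> cmp (fun e => f (fun i => e i.+1)).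
Proof. by move/cmp_subst; apply=> i; exact: cmp_var. Qed.

Lemma cmp_shift2 f : cmp f -> cmp (fun e => f (fun i => e i.+2)).
Proof. by move/cmp_subst; apply=> i; exact: cmp_var. Qed.

Lemma cmp0 : cmp (fun=> 0).
Proof. by exists 0 => n _; exists (RZero n) => e. Qed.

Lemma cmpS f : cmp f -> cmp (fun e => (f e).+1).
Proof.
move=> [N HN]; exists N => n /HN[F HF].
exists (RComp RSucc (fun=> F)) => e /=.
exists [tuple f e | i < 1]; split=> [i|]; first by rewrite tnth_mktuple.
by rewrite /thead tnth_mktuple.
Qed.

Lemma computes_prec n (f : recfun n) (g : recfun n.+2) (v : n.+1.-tuple nat) h :
  let u := [tuple of behead v] in
  computes f u (h 0) -> (forall k, computes g [tuple of k :: h k :: u] (h k.+1)) ->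
  computes (RPrec f g) v (h (thead v)).
Proof.
move=> u f0 gS; rewrite /computes -/computes.
by elim: (thead v) => [|k IHk] //; exists (h k).
Qed.

Lemma cmp_rec (a m : (nat -> nat) -> nat) b :
  cmp a -> cmp (fun e => b (e 0) (e 1) (fun i => e i.+2)) -> cmp m ->
  cmp (fun e => nat_rect (fun=> nat) (a e) (fun k r => b k r e) (m e)).
Proof.
move=> [Na Ha] [Nb Hb] [Nm Hm]; exists (maxn Na (maxn Nb Nm)) => n.
rewrite !geq_max => /and3P[/Ha[A {}Ha] leNb /Hm[M {}Hm]].
have /Hb[B {}Hb] : Nb <= n.+2 by exact/leqW/leqW.
(* Position 0 of the new argument list holds the number [m e] of iterations; the other positions
   copy the environment. *)
exists (RComp (RPrec A B) (fun i => if unlift ord0 i is Some j then RProj j else M)).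
move=> e; set v := [tuple of m e :: [tuple e i | i < n]]; exists v; split.
  move=> i; case: unliftP => [j|] ->; last by rewrite tnth0.
  by rewrite /= tnthS.
pose h := nat_rect (fun=> nat) (a e) (fun k r => b k r e).
have uE : [tuple of behead v] = [tuple e i | i < n] by exact: val_inj.
rewrite -[X in computes _ _ X]/(h (thead v)); apply: computes_prec => [|k].
  by rewrite uE; exact: Ha.
have := Hb (fun i => if i is j.+1 then if j is l.+1 then e l else h k else k).
congr (computes B _ _); apply: eq_from_tnth => i; rewrite tnth_mktuple.
case: (unliftP ord0 i) => [j|] -> //; rewrite tnthS.
case: (unliftP ord0 j) => [l|] -> //; by rewrite tnthS uE tnth_mktuple.
Qed.

Lemma cmp_const k : cmp (fun=> k).
Proof. by elim: k => [|k IHk]; [exact: cmp0 | exact: cmpS]. Qed.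


Lemma cmpD f g : cmp f -> cmp g -> cmp (fun e => f e + g e).
Proof.
move=> cf cg; apply: cmp_ext (cmp_rec (b := fun _ r _ => r.+1) cf _ cg) => [e|].
  by elim: (g e) => [|k /= ->]; rewrite ?addn0 ?addnS.
exact/cmpS/cmp_var.
Qed.

Lemma cmpM f g : cmp f -> cmp g -> cmp (fun e => f e * g e).
Proof.
move=> cf cg.
apply: cmp_ext (cmp_rec (b := fun _ r e => f e + r) cmp0 _ cg) => [e|].
  by elim: (g e) => [|k /= ->]; rewrite ?muln0 ?mulnS.
by apply: cmpD (cmp_var 1); exact: cmp_shift2.
Qed.

Lemma cmpX f g : cmp f -> cmp g -> cmp (fun e => f e ^ g e).
Proof.
move=> cf cg.
apply: cmp_ext (cmp_rec (b := fun _ r e => f e * r) (cmp_const 1) _ cg) => [e|].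
  by elim: (g e) => [|k /= ->]; rewrite ?expn0 ?expnS.
by apply: cmpM (cmp_var 1); exact: cmp_shift2.
Qed.

Lemma cmp_pred f : cmp f -> cmp (fun e => (f e).-1).
Proof.
move=> cf; apply: cmp_ext (cmp_rec (b := fun k _ _ => k) cmp0 (cmp_var 0) cf).
by move=> e; case: (f e).
Qed.

Lemma cmpB f g : cmp f -> cmp g -> cmp (fun e => f e - g e).
Proof.
move=> cf cg; apply: cmp_ext (cmp_rec (b := fun _ r _ => r.-1) cf _ cg) => [e|].
  by elim: (g e) => [|k /= ->]; rewrite ?subn0 ?subnS.
exact/cmp_pred/cmp_var.
Qed.

Lemma cmp_sum (m : (nat -> nat) -> nat) b :
  cmp m -> cmp (fun e => b (e 0) (fun i => e i.+1)) ->
  cmp (fun e => \sum_(i < m e) b i e).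
Proof.
move=> cm cb.
apply: cmp_ext (cmp_rec (b := fun k r e => r + b k e) cmp0 _ cm) => [e|].
  by elim: (m e) => [|k /= ->]; rewrite ?big_ord0 ?big_ord_recr.
apply: cmpD (cmp_var 1) _.
(* Variable 1 is skipped: it holds the partial sum, which [b] must not see. *)
have := cmp_subst cb (g := fun i e => e (if i is j.+1 then j.+2 else 0)).
by apply=> i; exact: cmp_var.
Qed.

Lemma cmp_eq0 f : cmp f -> cmp (fun e => f e == 0).
Proof.
move=> cf; have := cmpB (cmp_const 1) cf.
by apply: cmp_ext => e; case: (f e).
Qed.

Lemma cmp_not p : cmp (fun e => p e : bool) -> cmp (fun e => ~~ p e).
Proof. by move/cmp_eq0; apply: cmp_ext => e; case: (p e). Qed.

Lemma cmp_and p q : cmp (fun e => p e : bool) -> cmp (fun e => q e : bool) ->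
  cmp (fun e => p e && q e).
Proof. by move=> cp cq; apply: cmp_ext (cmpM cp cq) => e; rewrite mulnb. Qed.

Lemma cmp_imp p q : cmp (fun e => p e : bool) -> cmp (fun e => q e : bool) ->
  cmp (fun e => p e ==> q e).
Proof.
move=> cp cq; apply: cmp_ext (cmp_not (cmp_and cp (cmp_not cq))) => e.
by case: (p e) (q e) => [] [].
Qed.

Lemma cmp_leq f g : cmp f -> cmp g -> cmp (fun e => f e <= g e).
Proof. by move=> cf cg; exact: cmp_eq0 (cmpB cf cg). Qed.

Lemma cmp_eq f g : cmp f -> cmp g -> cmp (fun e => f e == g e).
Proof.
move=> cf cg; apply: cmp_ext (cmp_and (cmp_leq cf cg) (cmp_leq cg cf)) => e.
by rewrite eqn_leq.
Qed.

Lemma cmp_if p f g : cmp (fun e => p e : bool) -> cmp f -> cmp g ->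
  cmp (fun e => if p e then f e else g e).
Proof.
move=> cp cf cg.
apply: cmp_ext (cmpD (cmpM cp cf) (cmpM (cmp_not cp) cg)) => e.
by case: (p e); rewrite ?mul1n ?mul0n ?addn0.
Qed.

Definition exists_lt (m : nat) (p : nat -> bool) := [exists i : 'I_m, p i].
Definition forall_lt (m : nat) (p : nat -> bool) := [forall i : 'I_m, p i].

Lemma exists_ltP m (p : nat -> bool) : reflect (exists2 i, i < m & p i) (exists_lt m p).
Proof.
apply: (iffP existsP) => [[i pi]|[i ltim pi]]; first by exists i.
by exists (Ordinal ltim).
Qed.

Lemma forall_ltP m (p : nat -> bool) : reflect (forall i, i < m -> p i) (forall_lt m p).
Proof.
by apply: (iffP forallP) => [pm i ltim|pm i]; [exact: (pm (Ordinal ltim)) | exact: pm].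
Qed.

Lemma cmp_exists (m : (nat -> nat) -> nat) (p : nat -> (nat -> nat) -> bool) :
  cmp m -> cmp (fun e => p (e 0) (fun i => e i.+1)) ->
  cmp (fun e => exists_lt (m e) (fun i => p i e)).
Proof.
move=> cm cp; apply: cmp_ext (cmp_not (cmp_eq0 (cmp_sum (b := p) cm cp))) => e.
congr nat_of_bool; rewrite sum_nat_eq0 negb_forall.
by apply: eq_existsb => i; rewrite eqb0 negbK.
Qed.

Lemma cmp_forall (m : (nat -> nat) -> nat) (p : nat -> (nat -> nat) -> bool) :
  cmp m -> cmp (fun e => p (e 0) (fun i => e i.+1)) ->
  cmp (fun e => forall_lt (m e) (fun i => p i e)).
Proof.
move=> cm /cmp_not cp.
apply: cmp_ext (cmp_not (cmp_exists (p := fun i e => ~~ p i e) cm cp)) => e.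
by rewrite negb_exists; congr nat_of_bool; apply: eq_forallb => i; rewrite negbK.
Qed.

Lemma cmp_eqb p q : cmp (fun e => p e : bool) -> cmp (fun e => q e : bool) ->
  cmp (fun e => p e == q e).
Proof. by move=> cp cq; apply: cmp_ext (cmp_eq cp cq) => e; case: (p e) (q e) => [] []. Qed.

Lemma cmp_addb p q : cmp (fun e => p e : bool) -> cmp (fun e => q e : bool) ->
  cmp (fun e => p e (+) q e).
Proof.
by move=> cp cq; apply: cmp_ext (cmp_not (cmp_eqb cp cq)) => e; case: (p e) (q e) => [] [].
Qed.

(** The quotient counts the [i < f e] with [i.+1 * g e <= f e]. A zero divisor is split off, since
    the count would then be [f e] instead of 0. *)
Lemma cmp_div f g : cmp f -> cmp g -> cmp (fun e => f e %/ g e).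
Proof.
move=> cf cg; have cq : cmp (fun e => \sum_(i < f e) (i.+1 * g e <= f e)).
  apply: (cmp_sum (b := fun i e => i.+1 * g e <= f e) cf).
  by apply: cmp_leq; [apply: cmpM (cmpS (cmp_var 0)) _|]; exact: cmp_shift1.
apply: cmp_ext (cmp_if (cmp_eq0 cg) cmp0 cq) => e.
case: eqP => [->|/eqP]; rewrite ?divn0 // -lt0n => g_gt0.
under eq_bigr => i _ do rewrite -leq_divRL //.
rewrite -[RHS]card_ord -sum1_card (big_ord_widen (f e) (fun=> 1)) ?leq_div //.
by rewrite [RHS]big_mkcond; apply: eq_bigr => i _; case: ifP => // ->.
Qed.

Lemma cmp_mod f g : cmp f -> cmp g -> cmp (fun e => f e %% g e).
Proof.
move=> cf cg; apply: cmp_ext (cmpB cf (cmpM (cmp_div cf cg) cg)) => e.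
by rewrite [X in X - _](divn_eq (f e) (g e)) addKn.
Qed.

Lemma cmp_odd f : cmp f -> cmp (fun e => odd (f e)).
Proof.
by move=> cf; apply: cmp_ext (cmp_mod cf (cmp_const 2)) => e; rewrite modn2.
Qed.

Lemma cmp_half f : cmp f -> cmp (fun e => (f e)./2).
Proof.
by move=> cf; apply: cmp_ext (cmp_div cf (cmp_const 2)) => e; rewrite divn2.
Qed.

Lemma cmp_bool_case p (h : bool -> (nat -> nat) -> nat) :
  cmp (fun e => p e : bool) -> (forall b, cmp (h b)) -> cmp (fun e => h (p e) e).
Proof.
by move=> cp ch; apply: cmp_ext (cmp_if cp (ch true) (ch false)) => e; case: (p e).
Qed.

(** A function constant from [N] on is a finite table, computed by nested tests. This makes
    operations of a finite group recursive in the indices of its elements. *)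
Lemma cmp_table N (h : nat -> nat) f :
  (forall k, N <= k -> h k = h N) -> cmp f -> cmp (fun e => h (f e)).
Proof.
move=> hN cf; suff cM M : cmp (fun e => if f e < M then h (f e) else h N).
  by apply: cmp_ext (cM N) => e; case: ltnP => // /hN->.
elim: M => [|M IHM]; first exact: cmp_const.
apply: cmp_ext (cmp_if (cmp_eq cf (cmp_const M)) (cmp_const (h M)) IHM) => e.
by rewrite [f e < M.+1]ltnS [f e <= M]leq_eqVlt; case: eqP => [->|].
Qed.

Lemma cmp_recfun2 (h : nat -> nat -> nat) :
  cmp (fun e => h (e 0) (e 1)) ->
  exists A : recfun 2, forall x y, computes A [tuple x; y] (h x y).
Proof.
move=> [N /(_ N.+2 (leqW (leqnSn N)))[F HF]].
(* [F] has arity [N.+2]; its arguments past the first two are set to 0, the default value of [nth]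
   in the environment below. *)
exists (RComp F (fun i => if i < 2 then RProj (inord i) else RZero 2)) => x y.
exists [tuple nth 0 [:: x; y] i | i < N.+2]; split; last first.
  exact: HF (nth 0 [:: x; y]).
move=> i; rewrite tnth_mktuple; case: ltnP => [lti2|lei2] /=.
  by rewrite (tnth_nth 0) /= inordK.
by rewrite nth_default.
Qed.

Lemma cmp_expr2 f : cmp f -> cmp (fun e => 2 ^ f e).
Proof. by move=> cf; exact: cmpX (cmp_const 2) cf. Qed.

(** * Recursion over lists coded as numbers *)

Definition code_head (m : nat) : nat := logn 2 m.
Definition code_tail (m : nat) : nat := m %/ 2 ^ (code_head m).+1.

(** The code of [x :: s] is [2 ^ x] times the odd number [(CodeSeq.code s).*2.+1], so the head is
    its 2-adic valuation. *)
Lemma code_head_cons x s : code_head (CodeSeq.code (x :: s)) = x.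
Proof.
rewrite /code_head /= lognM ?expn_gt0 // pfactorK // (logn_coprime (p := 2)) ?addn0 //.
by rewrite coprime2n /= odd_double.
Qed.

Lemma code_tail_cons x s : code_tail (CodeSeq.code (x :: s)) = CodeSeq.code s.
Proof.
rewrite /code_tail code_head_cons /= expnSr divnMA mulKn ?expn_gt0 //.
by rewrite divn2 /= uphalf_double.
Qed.

Lemma iter_code_tail i s :
  iter i code_tail (CodeSeq.code s) = CodeSeq.code (drop i s).
Proof.
elim: i s => [|i IHi] s; first by rewrite drop0.
rewrite iterSr; case: s => [|x s]; last by rewrite code_tail_cons IHi.
by rewrite /code_tail div0n (IHi [::]).
Qed.

Lemma size_code s : size s <= CodeSeq.code s.
Proof.
elim: s => //= x s IHs; apply: leq_trans (leq_pmull _ _); last by rewrite expn_gt0.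
by rewrite ltnS -addnn (leq_trans IHs) // leq_addr.
Qed.

(** A list is at most as long as its code, so the code itself can serve as the number of iterations;
    the surplus ones meet the code 0 of the empty list and change nothing. *)
Lemma foldl_code (T : Type) (step : T -> nat -> T) z s :
  nat_rect (fun=> T) z (fun i r => let t := iter i code_tail (CodeSeq.code s) in
    if t == 0 then r else step r (code_head t)) (CodeSeq.code s) = foldl step z s.
Proof.
rewrite -[in RHS](take_oversize (size_code s)).
set F := (X in nat_rect _ _ X _); move: (CodeSeq.code s) => k.
elim: k => [|k /= ->]; first by rewrite take0.
rewrite /F iter_code_tail; case: (ltnP k (size s)) => [ltks|leks].
  rewrite (drop_nth 0) // (take_nth 0) // foldl_rcons code_head_cons.
  by rewrite /= muln_eq0 expn_eq0.
by rewrite drop_oversize // !take_oversize // leqW.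
Qed.

(** The valuation counts the [i] below the number for which [2 ^ i.+1] divides it; at 0 the sum is
    empty, in agreement with [logn]. *)
Lemma cmp_code_head f : cmp f -> cmp (fun e => code_head (f e)).
Proof.
move=> cf; have cb : cmp (fun e => 2 ^ (e 0).+1 %| f (fun i => e i.+1)).
  apply: cmp_eq0; apply: cmp_mod; first exact: cmp_shift1.
  exact/cmp_expr2/cmpS/cmp_var.
apply: cmp_ext (cmp_sum (b := fun i e => 2 ^ i.+1 %| f e) cf cb) => e.
have [->|f_gt0] := posnP (f e); first by rewrite big_ord0 /code_head logn0.
rewrite -[RHS]card_ord -sum1_card (big_ord_widen (f e) (fun=> 1)); last first.
  exact/ltnW/ltn_logl.
rewrite [RHS]big_mkcond; apply: eq_bigr => i _.
by rewrite pfactor_dvdn // /code_head; case: ifP => // ->.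
Qed.

Lemma cmp_code_tail f : cmp f -> cmp (fun e => code_tail (f e)).
Proof. by move=> cf; exact: cmp_div cf (cmp_expr2 (cmpS (cmp_code_head cf))). Qed.

Lemma cmp_foldl (z m : (nat -> nat) -> nat) step :
  cmp z -> cmp m -> cmp (fun e => step (e 0) (e 1) (fun i => e i.+2)) ->
  cmp (fun e => foldl (fun r l => step r l e) (z e) (CodeSeq.decode (m e))).
Proof.
move=> cz cm cs; pose t i e := iter i code_tail (m e).
have ct : cmp (fun e => t (e 0) (fun i => e i.+2)).
  apply: cmp_ext (cmp_rec (m := fun e => e 0) (b := fun _ r _ => code_tail r)
    (cmp_shift2 cm) _ (cmp_var 0)).
    by move=> e; rewrite /t; elim: (e 0) => //= k ->.
  exact/cmp_code_tail/cmp_var.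
apply: cmp_ext (cmp_rec (b := fun i r e => if t i e == 0 then r
    else step r (code_head (t i e)) e) cz _ cm).
  by move=> e; rewrite -foldl_code CodeSeq.decodeK.
apply: cmp_if; [exact: cmp_eq0 | exact: cmp_var |].
have := cmp_subst cs (g := fun i e => if i is j.+1 then
  if j is l.+1 then e l.+2 else code_head (t (e 0) (fun i => e i.+2)) else e 1).
by apply=> -[|[|i]]; [exact: cmp_var | exact: cmp_code_head | exact: cmp_var].
Qed.

Lemma cmp_all (m : (nat -> nat) -> nat) (p : nat -> (nat -> nat) -> bool) :
  cmp m -> cmp (fun e => p (e 0) (fun i => e i.+1)) ->
  cmp (fun e => all (fun l => p l e) (CodeSeq.decode (m e))).
Proof.
move=> cm cp.
apply: cmp_ext (cmp_foldl (step := fun r l e => r * p l e) (cmp_const 1) cm _) => [e|].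
  rewrite -[X in foldl _ X _]/(nat_of_bool true) -[RHS]/(nat_of_bool (true && _)).
  elim: (CodeSeq.decode _) (true) => [|l s IHs] b /=; first by rewrite andbT.
  by rewrite mulnb IHs andbA.
apply: cmpM (cmp_var 0) _.
by have := cmp_shift1 cp.
Qed.

(** * Graphs are determined by their cup product relation *)

Section Rigidity.
Local Open Scope ring_scope.

(* A variable field keeps unification from unfolding the arithmetic of 'F_2. *)
Variable K : finFieldType.
Hypothesis K2 : #|K| = 2.

Lemma K_eq01 (x : K) : x = 0 \/ x = 1.
Proof.
have /eqP E : [set 0; 1] == [set: K].
  by rewrite eqEcard subsetT cardsT K2 cards2 eq_sym oner_eq0.
have : x \in [set 0; 1] by rewrite E inE.
by rewrite !inE => /orP[] /eqP; [left | right].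
Qed.

Lemma K_neq0 (x : K) : x != 0 -> x = 1.
Proof. by case: (K_eq01 x) => ->; rewrite ?eqxx. Qed.

Lemma K_addrr (x : K) : x + x = 0.
Proof.
case: (K_eq01 x) => ->; first exact: addr0.
case: (K_eq01 (1 + 1)) => // /(canRL (addrK 1)); rewrite subrr => /eqP.
by rewrite oner_eq0.
Qed.

Definition delta (T : finType) (u : T) : {ffun T -> K} :=
  [ffun v => (v == u)%:R].

Definition supported (T : finType) (A : {set T}) : {set {ffun T -> K}} :=
  [set x : {ffun T -> K} | [forall v, (x v != 0) ==> (v \in A)]].

Lemma delta_supported (T : finType) (A : {set T}) u :
  u \in A -> delta u \in supported A.
Proof.
move=> uA; rewrite inE; apply/forallP => v; apply/implyP.
by rewrite ffunE; have [->|_] := eqVneq v u; rewrite ?uA ?implybT ?eqxx.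
Qed.

Lemma card_supported (T : finType) (A : {set T}) : #|supported A| = (2 ^ #|A|)%N.
Proof.
have -> : #|supported A| = #|pffun_on (0 : K) (mem A) (mem K)|.
  apply: eq_card => x; rewrite !inE; apply/forallP/pffun_onP => [xA|[xA _] v].
    by split=> [|v _ //]; apply/subsetP => v xv; apply: (implyP (xA v)).
  by apply/implyP => xv; apply: (subsetP xA).
by rewrite card_pffun_on K2.
Qed.

Lemma sum_delta (T : finType) (x : {ffun T -> K}) :
  x = \sum_(u | x u != 0) delta u.
Proof.
apply/ffunP => v; rewrite sum_ffunE.
under eq_bigr => u _ do rewrite ffunE.
have [xv0|xv] := eqVneq (x v) 0.
  rewrite big1 // => u xu; have [E|//] := eqVneq v u.
  by rewrite -E xv0 eqxx in xu.
rewrite (bigD1 v) //= eqxx big1 ?addr0 ?(K_neq0 xv) // => u /andP[_].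
by rewrite eq_sym => /negPf->.
Qed.

Section Graph.
Variables (T : finType) (adj : rel T).
Hypotheses (adjC : symmetric adj) (adjI : irreflexive adj).

(** The neighbours of [u] in the complementary graph; their number is the degree that defines the
    filtration. *)
Definition colink (u : T) : {set T} := [set v | (v != u) && ~~ adj u v].

(** [cup_raag] identifies this relation with the vanishing of the cup product. *)
Definition com (x y : {ffun T -> K}) : bool :=
  [forall u, forall v, adj u v ==> (x u * y v == x v * y u)].

Definition cent (x : {ffun T -> K}) := [set y | com x y].

Implicit Types x y z : {ffun T -> K}.

Lemma comP x y :
  reflect (forall u v, adj u v -> x u * y v = x v * y u) (com x y).
Proof.
apply: (iffP forallP) => [xy u v uv|xy u].
  by apply/eqP; exact: implyP (forallP (xy u) v) uv.
by apply/forallP => v; apply/implyP => /xy/eqP.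
Qed.

Lemma comxx x : com x x.
Proof. by apply/comP => u v _; rewrite mulrC. Qed.

Lemma com_sym x y : com x y = com y x.
Proof. by apply/comP/comP => xy u v /xy E; rewrite mulrC -E mulrC. Qed.

Lemma com_addr x y z : com x y -> com x z -> com x (y + z).
Proof.
move=> /comP xy /comP xz; apply/comP => u v uv.
by rewrite ffunE ffunE !mulrDr xy // xz.
Qed.

Lemma com_delta u v : ~~ adj u v -> com (delta u) (delta v).
Proof.
move=> Nuv; apply/comP => a b ab; rewrite !ffunE.
have [au|_] := eqVneq a u; have [bv|_] := eqVneq b v;
  have [bu|_] := eqVneq b u; have [av|_] := eqVneq a v;
  rewrite ?mul0r ?mulr0 //.
all: by move: ab Nuv; subst; rewrite ?adjI // 1?adjC => ->.
Qed.

(** On an edge from [w] to [v] the relation reads [x w * y v = x v * y w = 0], which forces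
    [y v = 0]. *)
Lemma com_supported x y w :
  com x y -> x w != 0 -> y w = 0 -> y \in supported (colink w).
Proof.
move=> /comP xy xw yw0; rewrite inE; apply/forallP => v; apply/implyP => yv.
rewrite inE; apply/andP; split; first by apply: contraNneq yv => ->; rewrite yw0.
by apply/negP => /xy/eqP; rewrite yw0 mulr0 mulf_eq0 (negPf xw) (negPf yv).
Qed.

(** If [x w] is nonzero, a vector commuting with [x] vanishes at [w] either as it stands or after
    adding [x], because the field has two elements. This gives two cosets that contain the
    centralizer. *)
Let cover x w := supported (colink w) :|: [set x + z | z in supported (colink w)].

Lemma cent_cover x w : x w != 0 -> cent x \subset cover x w.
Proof.
move=> xw; apply/subsetP => y; rewrite inE => xy; rewrite inE.
have [yw0|yw] := K_eq01 (y w); first by rewrite (com_supported xy).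
apply/orP; right; apply/imsetP; exists (x + y); last first.
  by rewrite addrA; apply/ffunP => v; rewrite !ffunE K_addrr add0r.
apply: (com_supported (x := x)) => //; first exact: com_addr (comxx x) xy.
by rewrite ffunE yw (K_neq0 xw) K_addrr.
Qed.

Lemma card_cover x w : (#|cover x w| <= 2 ^ #|colink w|.+1)%N.
Proof.
apply: leq_trans (leq_card_setU _ _) _; rewrite card_supported.
by rewrite card_imset ?card_supported ?addnn ?expnS ?mul2n //; exact: addrI.
Qed.

Lemma card_cent_le x w : x w != 0 -> (#|cent x| <= 2 ^ #|colink w|.+1)%N.
Proof.
by move=> xw; apply: leq_trans (card_cover x w); exact/subset_leq_card/cent_cover.
Qed.

(** In the equality case of the bound, the centralizer is the whole cover and so contains the basis
    vectors of [colink w]. *)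
Lemma cent_max x w k : x w != 0 -> (2 ^ #|colink w|.+1 <= #|cent x|)%N ->
  k \in colink w -> com x (delta k).
Proof.
move=> xw le_cent kw; have /eqP centE : cent x == cover x w.
  by rewrite eqEcard cent_cover //; apply: leq_trans (card_cover x w) le_cent.
have : delta k \in cent x by rewrite centE inE delta_supported.
by rewrite inE.
Qed.

(** Commuting with [delta u] means vanishing on the neighbours of [u], so the centralizer consists
    of the vectors supported on [u] and [colink u]. *)
Lemma card_cent_delta u : #|cent (delta u)| = (2 ^ #|colink u|.+1)%N.
Proof.
have -> : cent (delta u) = supported (u |: colink u).
  apply/setP => y; rewrite !inE; apply/comP/forallP => [uy v|yu a b ab].
    apply/implyP => yv; rewrite !inE.
    have [//|vu] := eqVneq v u; apply/negP => /uy.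
    by rewrite !ffunE eqxx mul1r (negPf vu) mul0r; exact/eqP.
  have y0 v : adj u v -> y v = 0.
    move=> uv; apply/eqP; apply: contraTT (yu v) => yv.
    have [E|vu] := eqVneq v u; first by rewrite E adjI in uv.
    by rewrite !inE yv uv (negPf vu).
  rewrite !ffunE; have [au|_] := eqVneq a u; have [bu|_] := eqVneq b u.
  - by move: ab; rewrite au bu adjI.
  - by rewrite y0 ?mulr0 ?mul0r // -au.
  - by rewrite (y0 a) ?mulr0 ?mul0r // -bu adjC.
  - by rewrite !mul0r.
by rewrite card_supported cardsU1 inE eqxx.
Qed.

End Graph.

Lemma additive_delta (T T' : finType) (f : {ffun T -> K} -> {ffun T' -> K}) :
  (forall x y, f (x + y) = f x + f y) ->
  forall x, f x = \sum_(u | x u != 0) f (delta u).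
Proof.
move=> fD x; rewrite [in LHS](sum_delta x); apply: (big_morph f fD).
by apply: (addrI (f 0)); rewrite -fD !addr0.
Qed.

(* Some term of the Leibniz expansion of the determinant is nonzero. *)
Lemma additive_transversal (T T' : finType)
    (f : {ffun T -> K} -> {ffun T' -> K}) g :
  cancel f g -> cancel g f -> (forall x y, f (x + y) = f x + f y) ->
  #|T| = #|T'| /\ exists2 s : T -> T', injective s & forall u, f (delta u) (s u) != 0.
Proof.
move=> fK gK fD.
have gD x y : g (x + y) = g x + g y by rewrite -{1}(gK x) -{1}(gK y) -fD fK.
have cTT' : #|T| = #|T'|.
  have := bij_eq_card (Bijective fK gK).
  by rewrite !card_ffun !K2 => /eqP; rewrite eqn_exp2l // => /eqP.
split=> //.
pose h (j : 'I_#|T|) : T' := enum_val (cast_ord cTT' j).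
pose h' (v : T') : 'I_#|T| := cast_ord (esym cTT') (enum_rank v).
have hK : cancel h h' by move=> j; rewrite /h /h' enum_valK cast_ordK.
have h'K : cancel h' h by move=> v; rewrite /h /h' cast_ordKV enum_rankK.
(* The matrices of [f] and [g] in the delta bases, with both vertex sets numbered by the same
   ordinals. *)
pose M := \matrix_(i, j < #|T|) f (delta (enum_val i)) (h j).
pose N := \matrix_(i, j < #|T|) g (delta (h i)) (enum_val j).
have MN : M *m N = 1%:M.
  apply/matrixP => i k; rewrite !mxE.
  have -> : (i == k)%:R = g (f (delta (enum_val i))) (enum_val k).
    by rewrite fK ffunE (inj_eq enum_val_inj) eq_sym.
  rewrite (additive_delta gD) sum_ffunE [RHS]big_mkcond [RHS](reindex h) /=; last first.
    by exists h' => ? _; rewrite ?hK ?h'K.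
  apply: eq_bigr => j _; rewrite !mxE; case: eqP => [->|/eqP/K_neq0->] /=.
    by rewrite mul0r.
  by rewrite mul1r.
have detM : \det M != 0.
  apply: contraTneq (oner_neq0 K) => M0.
  by rewrite negbK -(det1 K #|T|) -MN det_mulmx M0 mul0r.
have [s /prodf_neq0 sM] : exists s : 'S_#|T|, \prod_i M i (s i) != 0.
  apply/existsP; apply: contraNT detM => /existsPn M0.
  by rewrite [\det M]big1 // => s _; have := M0 s; rewrite negbK => /eqP->; rewrite mulr0.
exists (fun u => h (s (enum_rank u))) => [u v /(can_inj hK)/perm_inj/enum_rank_inj //|u].
by have := sM (enum_rank u) isT; rewrite mxE enum_rankK.
Qed.

Section Iso.
Variables (T T' : finType) (adj : rel T) (adj' : rel T').
Hypotheses (adjC : symmetric adj) (adjI : irreflexive adj).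
Variable f : {ffun T -> K} -> {ffun T' -> K}.
Hypotheses (f_inj : injective f) (fD : forall x y, f (x + y) = f x + f y).
Hypothesis f_com : forall x y, com adj x y -> com adj' (f x) (f y).

Lemma card_cent_morph x : (#|cent adj x| <= #|cent adj' (f x)|)%N.
Proof.
rewrite -(card_imset _ f_inj); apply/subset_leq_card/subsetP => _ /imsetP[y xy ->].
by move: xy; rewrite !inE; exact: f_com.
Qed.

(** [f] embeds the centralizer of [delta u], whose size is known exactly, into that of
    [f (delta u)], whose size is bounded through [w]. *)
Lemma colink_morph u w :
  f (delta u) w != 0 -> (#|colink adj u| <= #|colink adj' w|)%N.
Proof.
move=> fuw; rewrite -ltnS -(leq_exp2l (m := 2)) // -card_cent_delta //.
by apply: leq_trans (card_cent_morph _) _; exact: card_cent_le.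
Qed.

Lemma degree_filtration d (x : {ffun T -> K}) :
  (forall v, x v != 0 -> (d < #|colink adj v|)%N) ->
  forall w, f x w != 0 -> (d < #|colink adj' w|)%N.
Proof.
move=> xd w; rewrite (additive_delta fD) sum_ffunE => fxw.
have [/existsP[v /andP[xv fv]]|/existsPn vN] :=
  boolP [exists v, (x v != 0) && (f (delta v) w != 0)].
  exact: leq_trans (xd v xv) (colink_morph fv).
move: fxw; rewrite big1 ?eqxx // => v xv.
by have := vN v; rewrite xv negbK => /eqP.
Qed.

Lemma sum_colink_le (s : T -> T') : injective s -> #|T| = #|T'| ->
  (forall u, f (delta u) (s u) != 0) ->
  (\sum_u #|colink adj u| <= \sum_w #|colink adj' w| ?=
     iff [forall u, #|colink adj u| == #|colink adj' (s u)|])%N.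
Proof.
move=> s_inj cTT' fs; rewrite [X in (_ <= X ?= iff _)%N](reindex s) /=; last first.
  by apply/onW_bij/inj_card_bij; rewrite ?cTT'.
apply: (leqif_sum (P := predT)) => u _; split=> //; exact: colink_morph.
Qed.

End Iso.

Lemma graph_rigidity (T T' : finType) (adj : rel T) (adj' : rel T')
    (f : {ffun T -> K} -> {ffun T' -> K}) (g : {ffun T' -> K} -> {ffun T -> K}) :
  symmetric adj -> irreflexive adj -> symmetric adj' -> irreflexive adj' ->
  cancel f g -> cancel g f -> (forall x y, f (x + y) = f x + f y) ->
  (forall x y, com adj x y -> com adj' (f x) (f y)) ->
  (forall x y, com adj' x y -> com adj (g x) (g y)) ->
  exists2 s : T -> T', bijective s & forall u v, adj u v = adj' (s u) (s v).
Proof.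
move=> adjC adjI adjC' adjI' fK gK fD f_com g_com.
have gD x y : g (x + y) = g x + g y by rewrite -{1}(gK x) -{1}(gK y) -fD fK.
have [cTT' [s s_inj fs]] := additive_transversal fK gK fD.
have [_ [s' s'_inj gs']] := additive_transversal gK fK gD.
have leT := sum_colink_le adjC adjI (can_inj fK) f_com s_inj cTT' fs.
have geT := sum_colink_le adjC' adjI' (can_inj gK) g_com s'_inj (esym cTT') gs'.
(* The degree sums bound each other, hence agree, and the equality clause makes [s] preserve every
   degree. *)
have /forallP dE : [forall u, #|colink adj u| == #|colink adj' (s u)|].
  by rewrite -(geq_leqif leT) geT.
(* If [s] made nonadjacent [u] and [v] adjacent, the images of [delta u] and [delta v] would agree
   up to terms of higher degree: their sum [l] would lie too deep in the filtration. *)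
have s_col u v : v \in colink adj u -> s v \in colink adj' (s u).
  rewrite !inE => /andP[vu Nuv]; rewrite (inj_eq s_inj) vu /=; apply/negP => suv.
  pose x := f (delta u); pose y := f (delta v); pose l := y + x.
  have xy : com adj' x y by exact/f_com/com_delta.
  have yx : com adj' y x by rewrite com_sym.
  have [xu yv] : x (s u) != 0 /\ y (s v) != 0 by split; exact: fs.
  have : x (s v) * y (s u) != 0.
    by rewrite -(comP _ _ _ xy _ _ suv) mulf_neq0.
  rewrite mulf_eq0 negb_or => /andP[xv yu].
  have dle := colink_morph adjC adjI (can_inj fK) f_com.
  (* Each of [x] and [y] is nonzero at both [s u] and [s v], so the degrees of [u] and [v] bound
     each other. *)
  have duv : #|colink adj u| = #|colink adj v|.
    by apply/anti_leq/andP; split; [rewrite (eqP (dE v)) | rewrite (eqP (dE u))]; exact: dle.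
  have cx k : k \in colink adj' (s u) -> com adj' x (delta k).
    apply: cent_max => //; rewrite -(eqP (dE u)) -card_cent_delta //.
    by apply: card_cent_morph f_com _; exact: can_inj fK.
  have cy k : k \in colink adj' (s u) -> com adj' y (delta k).
    apply: cent_max => //; rewrite -(eqP (dE u)) duv -card_cent_delta //.
    by apply: card_cent_morph f_com _; exact: can_inj fK.
  have lw w : x w != 0 -> y w != 0 -> l w = 0.
    by move=> /K_neq0 xw /K_neq0 yw; rewrite ffunE xw yw K_addrr.
  have xl : com adj' x l by apply: com_addr => //; exact: comxx.
  have ld k : l k != 0 -> (#|colink adj u| < #|colink adj' k|)%N.
    move=> lk.
    have sup w : x w != 0 -> y w != 0 -> k \in colink adj' w.
      move=> xw yw; have := com_supported xl xw (lw w xw yw).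
      by rewrite inE => /forallP/(_ k)/implyP; apply.
    have ku := sup _ xu yu; have kv := sup _ xv yv.
    (* A vertex [a] of [colink adj' (s u)] adjacent to [k] would give [l k = 0], as [delta a]
       commutes with [x] and [y]. Since [s v] is adjacent to [s u], the left side has one element
       more than [colink adj' (s u)]: two are added and [k] is removed. *)
    have sub : s u |: (s v |: (colink adj' (s u) :\ k)) \subset colink adj' k.
      apply/subsetP => a; rewrite !inE => /or3P[/eqP->|/eqP->|].
      - by move: ku; rewrite inE eq_sym adjC'.
      - by move: kv; rewrite inE eq_sym adjC'.
      case/and3P=> ak au aN; rewrite ak /=; apply/negP => ka.
      have acol : a \in colink adj' (s u) by rewrite inE au.
      have /comP/(_ _ _ ka) : com adj' (delta a) l.
        by apply: com_addr; rewrite com_sym; [exact: cy | exact: cx].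
      rewrite !ffunE eqxx mul1r eq_sym (negPf ak) mul0r => /esym.
      by move: lk; rewrite ffunE => /eqP.
    move/subset_leq_card: sub; apply: leq_trans.
    rewrite (eqP (dE u)) (cardsD1 k (colink adj' (s u))) ku !cardsU1 !inE.
    by rewrite eqxx (inj_eq s_inj) eq_sym (negPf vu) suv /= !andbF.
  (* [g l] is [delta v + delta u], which is 1 at [v], a vertex whose degree is only that of [u]. *)
  have := degree_filtration adjC' adjI' (can_inj gK) gD g_com ld (w := v).
  by rewrite gD !fK !ffunE eqxx (negPf vu) addr0 duv ltnn => /(_ (oner_neq0 K)).
(* Equal cardinals turn the inclusion into an equality, so adjacency is preserved both ways. *)
have colE u : s @: colink adj u = colink adj' (s u).
  apply/eqP; rewrite eqEcard card_imset // (eqP (dE u)) leqnn andbT.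
  by apply/subsetP => _ /imsetP[v uv ->]; exact: s_col.
exists s => [|u v]; first by apply: inj_card_bij; rewrite ?cTT'.
have [->|vu] := eqVneq v u; first by rewrite adjI adjI'.
have : (v \in colink adj u) = (s v \in colink adj' (s u)).
  by rewrite -colE mem_imset.
by rewrite !inE (inj_eq s_inj) vu /= => /negb_inj.
Qed.

End Rigidity.

(** * Maps to the Heisenberg group *)

Section Heisenberg.
Local Open Scope ring_scope.
Variable K : finFieldType.

(* Unitriangular 3 x 3 matrices, as (entry 12, entry 23, entry 13). *)
Definition heis : Type := (K * K * K)%type.
HB.instance Definition _ := Finite.on heis.

Definition heis_mul (g h : heis) : heis :=
  (g.1.1 + h.1.1, g.1.2 + h.1.2, g.2 + h.2 + g.1.1 * h.1.2).
Definition heis_inv (g : heis) : heis :=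
  (- g.1.1, - g.1.2, g.1.1 * g.1.2 - g.2).
Definition heis_one : heis := (0, 0, 0).

Lemma heis_mulA : associative heis_mul.
Proof.
move=> [[a b] c] [[a' b'] c'] [[a'' b''] c'']; rewrite /heis_mul /=.
by congr (_, _, _); ring.
Qed.

Lemma heis_mul1 : left_id heis_one heis_mul.
Proof. by move=> [[a b] c]; rewrite /heis_mul /= !add0r mul0r addr0. Qed.

Lemma heis_mulr1 : right_id heis_one heis_mul.
Proof. by move=> [[a b] c]; rewrite /heis_mul /= mulr0 !addr0. Qed.

Lemma heis_mulV : left_inverse heis_one heis_inv heis_mul.
Proof.
move=> [[a b] c]; rewrite /heis_mul /= !addNr mulNr.
by congr (_, _, _); rewrite subrK subrr.
Qed.

Lemma heis_mulrV : right_inverse heis_one heis_inv heis_mul.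
Proof.
move=> [[a b] c]; rewrite /heis_mul /= !subrr mulrN.
by congr (_, _, _); rewrite [c + _]addrC subrK subrr.
Qed.

HB.instance Definition _ :=
  isGroup.Build heis heis_mulA heis_mul1 heis_mulr1 heis_mulV heis_mulrV.

Lemma heis_fst (g h : heis) : (g * h)%g.1 = (g.1.1 + h.1.1, g.1.2 + h.1.2).
Proof. by []. Qed.

End Heisenberg.

(** * Evaluation of words and homomorphisms out of presented groups *)

Section Evaluation.
Local Open Scope group_scope.

Lemma multiplicative1 (G H : groupType) (h : {multiplicative G -> H}) : h 1 = 1.
Proof. by apply: (mulgI (h 1)); rewrite -gmulfM !mulg1. Qed.

Lemma multiplicativeV (G H : groupType) (h : {multiplicative G -> H}) x :
  h x^-1 = (h x)^-1.
Proof.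
by apply/esym/mulg1_eq; rewrite -gmulfM mulgV multiplicative1.
Qed.

Definition letter (X : Type) (T : groupType) (t : X -> T) (l : X * bool) : T :=
  if l.2 then (t l.1)^-1 else t l.1.

Definition evalw (X : Type) (T : groupType) (t : X -> T) (w : word X) : T :=
  foldl (fun g l => g * letter t l) 1 w.

Lemma evalw_cat (X : Type) (T : groupType) (t : X -> T) u v :
  evalw t (u ++ v) = evalw t u * evalw t v.
Proof.
rewrite /evalw foldl_cat; move: (foldl _ _ u) => g.
elim/last_ind: v => [|v l IHv]; first by rewrite mulg1.
by rewrite !foldl_rcons IHv mulgA.
Qed.

Lemma evalw_cons (X : Type) (T : groupType) (t : X -> T) l w :
  evalw t (l :: w) = letter t l * evalw t w.
Proof. by rewrite -cat1s evalw_cat /evalw /= mul1g. Qed.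

Lemma evalw1 (X : Type) (T : groupType) (t : X -> T) x :
  evalw t [:: (x, false)] = t x.
Proof. by rewrite evalw_cons mulg1. Qed.

Lemma evalw_morph (X : Type) (T T' : groupType) (t : X -> T)
    (h : {multiplicative T -> T'}) w :
  h (evalw t w) = evalw (fun x => h (t x)) w.
Proof.
elim: w => [|[x b] w IHw]; first exact: multiplicative1.
by rewrite !evalw_cons gmulfM IHw /letter; case: b; rewrite //= multiplicativeV.
Qed.

Definition kills (X : Type) (R : word X -> Prop) (T : groupType) (t : X -> T) :=
  forall r, R r -> evalw t r = 1.

Lemma evalw_cong (X : Type) (R : word X -> Prop) (T : groupType) (t : X -> T) u v :
  kills R t -> cong R u v -> evalw t u = evalw t v.
Proof.
move=> tR; elim=> {u v} //.
- by move=> u v w _ -> _ ->.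
- by move=> u v u' v' _ E _ E'; rewrite !evalw_cat E E'.
- move=> x b; rewrite !evalw_cons /letter.
  by case: b; rewrite /= mulg1 ?mulgV ?mulVg.
Qed.

Section Presented.
Variables (X : choiceType) (R : word X -> Prop).

Definition gen (x : X) : presented R := pword R [:: (x, false)].

Lemma evalw_gen w : evalw gen w = pword R w.
Proof.
elim: w => [//|[x b] w IHw]; rewrite evalw_cons IHw -cat1s pword_cat.
by congr (_ * _); case: b => //; rewrite /letter /= /gen -[LHS]pword_inv.
Qed.

Lemma kills_gen : kills R gen.
Proof. by move=> r Rr; rewrite evalw_gen; apply/pwordP/cong_relator. Qed.

Lemma presented_lift (T : groupType) (t : X -> T) : kills R t ->
  exists h : {multiplicative presented R -> T}, forall w, h (pword R w) = evalw t w.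
Proof.
move=> tR; pose h (p : presented R) := evalw t (repr p).
have hE w : h (pword R w) = evalw t w.
  by apply: evalw_cong tR _; apply/pwordP; rewrite pword_repr.
have hM : {morph h : p q / p * q}.
  by move=> p q; rewrite -evalw_cat -hE.
pose H : {multiplicative presented R -> T} :=
  HB.pack h (isMultiplicative.Build _ _ h hM).
by exists H.
Qed.

End Presented.

Lemma isomorphicP (G H : groupType) : isomorphic G H ->
  exists (f : {multiplicative G -> H}) (g : {multiplicative H -> G}),
    cancel f g /\ cancel g f.
Proof.
move=> [f [g fK gK]]; have gM : {morph g : x y / x * y}.
  by move=> x y; apply: (can_inj fK); rewrite gmulfM !gK.
pose g' : {multiplicative H -> G} := HB.pack g (isMultiplicative.Build _ _ g gM).
by exists f, g'.
Qed.

Lemma isomorphic_sym (G H : groupType) : isomorphic G H -> isomorphic H G.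
Proof. by case/isomorphicP=> f [g [fK gK]]; exists g; exists f. Qed.

Lemma isomorphic_trans (G H J : groupType) :
  isomorphic G H -> isomorphic H J -> isomorphic G J.
Proof. by move=> [f fb] [g gb]; exists (g \o f); exact: bij_comp. Qed.

Lemma isomorphic_raag (D D' : sgraph) (s : vertex D -> vertex D') :
  bijective s -> (forall u v, adj u v = adj (s u) (s v)) ->
  isomorphic (raag D) (raag D').
Proof.
move=> [s' sK s'K] s_adj.
have raag_map (E E' : sgraph) (r : vertex E -> vertex E') :
    (forall u v, adj u v -> adj (r u) (r v)) ->
    exists h : {multiplicative raag E -> raag E'},
      forall w, h (pword _ w) = evalw (fun u => gen _ (r u)) w.
  move=> r_adj; apply: presented_lift => _ [u [v [uv ->]]].
  rewrite -[LHS]/(evalw (gen _) [:: (r u, false); (r v, false); (r u, true); (r v, true)]).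
  by apply: kills_gen; exists (r u), (r v); split=> //; exact: r_adj.
have [|f fE] := raag_map D D' s; first by move=> u v; rewrite s_adj.
have [|g gE] := raag_map D' D s'; first by move=> u v uv; rewrite s_adj !s'K.
exists f; exists g => p; rewrite -[p]pword_repr.
  rewrite fE evalw_morph -[RHS]evalw_gen; congr (evalw _ _); apply/funext => u.
  by rewrite gE evalw1 sK.
rewrite gE evalw_morph -[RHS]evalw_gen; congr (evalw _ _); apply/funext => u.
by rewrite fE evalw1 s'K.
Qed.

End Evaluation.

(** * The cup product relation and its invariance under isomorphism *)

Section Cup.
Local Open Scope ring_scope.

(* For the cup product relation of a presentation of a right-angled Artin group,
   r x x singles out the x : X -> K that extend to homomorphisms. *)
Definition reliso (A B : zmodType) (r : A -> A -> Prop) (s : B -> B -> Prop) : Prop :=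
  exists (f : A -> B) (g : B -> A),
    [/\ forall x y, r x y -> s (f x) (f y), forall x y, s x y -> r (g x) (g y),
        forall x, r x x -> g (f x) = x, forall y, s y y -> f (g y) = y &
        forall x y, r x x -> r y y -> f (x + y) = f x + f y].

Lemma reliso_trans (A B C : zmodType) (r : A -> A -> Prop) (s : B -> B -> Prop)
    (t : C -> C -> Prop) : reliso r s -> reliso s t -> reliso r t.
Proof.
move=> [f [g [rf sg fK gK fD]]] [f' [g' [sf' tg' f'K g'K f'D]]].
exists (f' \o f), (g \o g'); split=> /=.
- by move=> x y /rf/sf'.
- by move=> x y /tg'/sg.
- by move=> x rx; rewrite f'K ?fK //; exact: rf.
- by move=> y ty; rewrite gK ?g'K //; exact: tg'.
- by move=> x y rx ry; rewrite fD // f'D //; exact: rf.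
Qed.

Variable K : finFieldType.

Definition expsum (X : Type) (a : X -> K) (w : word X) : K :=
  \sum_(l <- w) (if l.2 then - a l.1 else a l.1).

Definition triple (X : Type) (a b c : X -> K) (x : X) : heis K := (a x, b x, c x).

Lemma evalw_triple (X : Type) (a b c : X -> K) w :
  (evalw (triple a b c) w).1 = (expsum a w, expsum b w).
Proof.
rewrite /expsum; elim: w => [|[x e] w IHw]; first by rewrite !big_nil.
by rewrite evalw_cons heis_fst IHw !big_cons; case: e.
Qed.

(* The class c in the definition is a primitive of minus the cup product of a
   and b : X -> K, viewed as classes in the first cohomology of < X | R >. *)
Definition cup (X : finType) (R : word X -> Prop) (a b : {ffun X -> K}) : Prop :=
  exists c : X -> K, kills R (triple a b c).

Section Push.
Variables (X Y : finType) (R : word X -> Prop) (S : word Y -> Prop).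
Variable F : {multiplicative presented S -> presented R}.

(** The pullback of classes along [F]. It is computed on chosen words, which keeps it additive on
    all functions; the choice does not matter for those that extend to homomorphisms. *)
Definition push (a : {ffun X -> K}) : {ffun Y -> K} :=
  [ffun y => expsum a (repr (F (gen S y)))].

Lemma pushD a b : push (a + b) = push a + push b.
Proof.
apply/ffunP => y; rewrite !ffunE -big_split; apply: eq_bigr => l _.
by rewrite ffunE; case: ifP => // _; rewrite opprD.
Qed.

(** The lift to the Heisenberg group, composed with [F], is determined by its values on generators:
    their first two entries are the pullbacks, and [c'] collects the third. *)
Lemma push_spec (a b : {ffun X -> K}) c : kills R (triple a b c) ->
  exists2 h : {multiplicative presented R -> heis K},
    forall w, h (pword R w) = evalw (triple a b c) w &
    exists c', forall w, h (F (pword S w)) = evalw (triple (push a) (push b) c') w.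
Proof.
move=> /presented_lift[h hE]; exists h => //.
exists (fun y => (h (F (gen S y))).2) => w.
rewrite -evalw_gen !evalw_morph; congr (evalw _ _); apply/funext => y.
rewrite /triple [LHS]surjective_pairing; congr (_, _).
by rewrite -[F _]pword_repr hE evalw_triple !ffunE.
Qed.

Lemma push_cup a b : cup R a b -> cup S (push a) (push b).
Proof.
move=> [c /push_spec[h hE [c' c'E]]]; exists c' => r Sr.
by rewrite -c'E -evalw_gen kills_gen // !multiplicative1.
Qed.

End Push.

(** [cup R a a] makes [a] extend to a homomorphism, so its value on any word representing [gen R x]
    is [a x]. *)
Lemma pushK (X Y : finType) (R : word X -> Prop) (S : word Y -> Prop)
    (F : {multiplicative presented S -> presented R})
    (G : {multiplicative presented R -> presented S}) :
  cancel G F -> forall a, cup R a a -> push G (push F a) = a.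
Proof.
move=> GK a [c /(push_spec F)[h hE [c' c'E]]]; apply/ffunP => x; rewrite ffunE.
have := c'E (repr (G (gen R x))); rewrite pword_repr GK hE evalw1.
by move/(congr1 fst); rewrite evalw_triple => -[].
Qed.

Lemma isomorphic_reliso (X Y : finType) (R : word X -> Prop) (S : word Y -> Prop) :
  isomorphic (presented R) (presented S) -> reliso (cup R) (cup S).
Proof.
case/isomorphicP=> f [g [fK gK]]; exists (push g), (push f); split.
- by move=> a b; exact: push_cup.
- by move=> a b; exact: push_cup.
- by move=> a; exact: pushK.
- by move=> a; exact: pushK.
- by move=> a b _ _; exact: pushD.
Qed.

(** Two Heisenberg matrices commute exactly when the cross terms in the 13 entries of their two
    products agree. The third coordinate [c] cancels, so [c = 0] serves. *)
Lemma cup_raag (D : sgraph) (a b : {ffun vertex D -> K}) :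
  cup (fun w : word (vertex D) => exists u v : vertex D,
    adj u v /\ w = [:: (u, false); (v, false); (u, true); (v, true)]) a b
  <-> com (@adj D) a b.
Proof.
have relE (c : vertex D -> K) u v :
    evalw (triple a b c) [:: (u, false); (v, false); (u, true); (v, true)] = 1%g
    <-> a u * b v = a v * b u.
  rewrite !evalw_cons mulg1 /letter /=.
  set x := triple a b c u; set y := triple a b c v.
  rewrite !mulgA; split=> [/(congr1 (fun z => z * y * x)%g)|E].
    rewrite !mulgVK mul1g => /(congr1 snd); rewrite /= [c v + c u]addrC.
    exact: addrI.
  have -> : (x * y = y * x)%g by congr (_, _, _); rewrite /= ?E 1?[c u + _]addrC // addrC.
  by rewrite mulgK mulgV.
split=> [[c cR]|/comP ab].
  by apply/comP => u v uv; apply/(relE c)/cR; exists u, v.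
by exists (fun=> 0) => _ [u [v [/ab uv ->]]]; apply/relE.
Qed.

Hypothesis K2 : #|K| = 2.

(** By [comxx] every function on the vertices is a class, so the guards in [reliso] always hold and
    [graph_rigidity] applies to the full spaces. *)
Lemma reliso_raag (D D' : sgraph) :
  reliso (@cup _ (fun w : word (vertex D) => exists u v : vertex D,
            adj u v /\ w = [:: (u, false); (v, false); (u, true); (v, true)]))
    (@cup _ (fun w : word (vertex D') => exists u v : vertex D',
            adj u v /\ w = [:: (u, false); (v, false); (u, true); (v, true)])) ->
  isomorphic (raag D) (raag D').
Proof.
move=> [f [g [fr gs fK gK fD]]].
have [] := @graph_rigidity K K2 _ _ (@adj D) (@adj D') f g.
- exact: adj_sym.
- exact: adj_irr.
- exact: adj_sym.
- exact: adj_irr.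
- by move=> x; apply: fK; apply/cup_raag/comxx.
- by move=> x; apply: gK; apply/cup_raag/comxx.
- by move=> x y; apply: fD; apply/cup_raag/comxx.
- by move=> x y /cup_raag/fr/cup_raag.
- by move=> x y /cup_raag/gs/cup_raag.
by move=> s s_bij s_adj; exact: isomorphic_raag s_bij s_adj.
Qed.

End Cup.

(** * The decision procedure on codes *)

Definition digit (B y i : nat) : nat := y %/ B ^ i %% B.

Lemma digitS B y i x : x < B -> digit B (x + B * y) i.+1 = digit B y i.
Proof.
move=> ltxB; rewrite /digit expnS divnMA addnC mulnC divnMDl; last exact: leq_ltn_trans ltxB.
by rewrite (divn_small ltxB) addn0.
Qed.

(** Finite tables are coded by numbers below an explicit bound, which makes searches over maps
    bounded. *)
Lemma digits_exist B m (f : nat -> nat) : (forall i, i < m -> f i < B) ->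
  exists2 y, y < B ^ m & forall i, i < m -> digit B y i = f i.
Proof.
elim: m f => [|m IHm] f fB; first by exists 0.
have [|y ltyB yf] := IHm (fun i => f i.+1); first by move=> i ltim; apply: fB.
have f0B := fB 0 isT; exists (f 0 + B * y) => [|[|i] ltim].
- rewrite expnS; apply: (@leq_trans (B + B * y)); first by rewrite ltn_add2r.
  by rewrite -mulnS leq_mul2l ltyB orbT.
- by rewrite /digit expn0 divn1 addnC mulnC modnMDl modn_small.
- by rewrite digitS // yf.
Qed.

Definition bit (a i : nat) : bool := odd (a %/ 2 ^ i).

Lemma bits_exist m (p : nat -> bool) :
  exists2 a, a < 2 ^ m & forall i, i < m -> bit a i = p i.
Proof.
have [|a lta aE] := @digits_exist 2 m (fun i => p i : nat).
  by move=> i _; case: (p i).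
by exists a => // i /aE; rewrite /digit modn2 /bit; case: (odd _) (p i) => [] [].
Qed.

Lemma bits_inj m a b : a < 2 ^ m -> b < 2 ^ m ->
  (forall i, i < m -> bit a i = bit b i) -> a = b.
Proof.
elim: m a b => [|m IHm] a b; first by rewrite !ltnS !leqn0 => /eqP-> /eqP->.
move=> lta ltb ab; rewrite -(odd_double_half a) -(odd_double_half b).
have := ab 0 isT; rewrite /bit !divn1 => ->; congr (_ + _.*2).
apply: IHm => [||i ltim]; rewrite -?divn2 ?ltn_divLR -?expnSr //.
by have := ab i.+1 ltim; rewrite /bit expnS !divnMA.
Qed.

Section Decision.
Variable K : finFieldType.

Definition heis_rank (g : heis K) : nat := index g (enum {: heis K}).
(** The default value makes every function of [heis_nth r] constant in [r] beyond the order of the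
    group, as [cmp_table] requires. *)
Definition heis_nth (r : nat) : heis K := nth 1%g (enum {: heis K}) r.

Lemma heis_rankK : cancel heis_rank heis_nth.
Proof. by move=> g; rewrite /heis_nth nth_index // mem_enum. Qed.

Definition bitr (a i : nat) : K := ((bit a i : nat)%:R)%R.

Definition eval_step (a b d r l : nat) : nat :=
  heis_rank (heis_nth r * letter (triple (bitr a) (bitr b) (bitr d)) (l./2, odd l))%g.

Definition eval_code (a b d w : nat) : nat :=
  foldl (eval_step a b d) (heis_rank 1%g) (CodeSeq.decode w).

Definition kills_code (c a b d : nat) : bool :=
  all (fun w => eval_code a b d w == heis_rank 1%g) (CodeSeq.decode (code_tail c)).

Definition cup_code (c a b : nat) : bool :=
  exists_lt (2 ^ code_head c) (fun d => kills_code c a b d).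

(* A vector over F_2 is the number with these binary digits, and a map between
   such vectors is the number whose digits, in base 2 ^ dimension, are its values. *)
Definition morph_code (c c' y z : nat) : bool :=
  forall_lt (2 ^ code_head c) (fun a =>
    (cup_code c a a ==>
       (digit (2 ^ code_head c) z (digit (2 ^ code_head c') y a) == a)) &&
    forall_lt (2 ^ code_head c) (fun b =>
      cup_code c a b ==>
      cup_code c' (digit (2 ^ code_head c') y a) (digit (2 ^ code_head c') y b))).

(** Instead of computing the digitwise sum of [a] and [b], the test runs over all [s] and keeps
    those with the right bits. *)
Definition add_code (c c' y : nat) : bool :=
  forall_lt (2 ^ code_head c) (fun a => forall_lt (2 ^ code_head c) (fun b =>
  forall_lt (2 ^ code_head c) (fun s =>
    (cup_code c a a && cup_code c b b &&
     forall_lt (code_head c) (fun i => bit s i == bit a i (+) bit b i)) ==>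
    forall_lt (code_head c') (fun i =>
      bit (digit (2 ^ code_head c') y s) i ==
      bit (digit (2 ^ code_head c') y a) i (+) bit (digit (2 ^ code_head c') y b) i)))).

(** The bounds are the numbers of all maps between the two vector spaces, in either direction. *)
Definition reliso_code (c c' : nat) : bool :=
  exists_lt ((2 ^ code_head c') ^ (2 ^ code_head c)) (fun y =>
  exists_lt ((2 ^ code_head c) ^ (2 ^ code_head c')) (fun z =>
    morph_code c c' y z && morph_code c' c z y && add_code c c' y)).

Section Computable.
Implicit Types a b c d f w y z : (nat -> nat) -> nat.

Lemma cmp_bit a f : cmp a -> cmp f -> cmp (fun e => bit (a e) (f e)).
Proof. by move=> ca cf; exact: cmp_odd (cmp_div ca (cmp_expr2 cf)). Qed.

Lemma cmp_digit b y f :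
  cmp b -> cmp y -> cmp f -> cmp (fun e => digit (b e) (y e) (f e)).
Proof. by move=> cb cy cf; exact: cmp_mod (cmp_div cy (cmpX cb cf)) cb. Qed.

Lemma cmp_eval_step a b d f w : cmp a -> cmp b -> cmp d -> cmp f -> cmp w ->
  cmp (fun e => eval_step (a e) (b e) (d e) (f e) (w e)).
Proof.
move=> ca cb cd cf cw; have ch := cmp_half cw.
(* A step depends on the letter only through its sign and the three bits of its generator. Splitting
   on these four booleans leaves a finite table in the accumulated value. *)
pose t (x y z : bool) : unit -> heis K :=
  triple (fun=> (x : nat)%:R%R) (fun=> (y : nat)%:R%R) (fun=> (z : nat)%:R%R).
apply: (cmp_bool_case (p := fun e => odd (w e)) (h := fun (s : bool) e =>
  heis_rank (heis_nth (f e) * letter (t (bit (a e) (w e)./2) (bit (b e) (w e)./2) (bit (d e) (w e)./2)) (tt, s))%g))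
  => [|s]; first exact: cmp_odd.
apply: (cmp_bool_case (p := fun e => bit (a e) (w e)./2) (h := fun (x : bool) e =>
  heis_rank (heis_nth (f e) * letter (t x (bit (b e) (w e)./2) (bit (d e) (w e)./2)) (tt, s))%g))
  => [|x]; first exact: cmp_bit.
apply: (cmp_bool_case (p := fun e => bit (b e) (w e)./2) (h := fun (y : bool) e =>
  heis_rank (heis_nth (f e) * letter (t x y (bit (d e) (w e)./2)) (tt, s))%g))
  => [|y]; first exact: cmp_bit.
apply: (cmp_bool_case (p := fun e => bit (d e) (w e)./2) (h := fun (z : bool) e =>
  heis_rank (heis_nth (f e) * letter (t x y z) (tt, s))%g))
  => [|z]; first exact: cmp_bit.
apply: (@cmp_table #|{: heis K}|
  (fun r => heis_rank (heis_nth r * letter (t x y z) (tt, s))%g)) => // k.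
by rewrite cardE => lek; rewrite /heis_nth !nth_default.
Qed.

Lemma cmp_kills_code c a b d : cmp c -> cmp a -> cmp b -> cmp d ->
  cmp (fun e => kills_code (c e) (a e) (b e) (d e)).
Proof.
move=> cc ca cb cd.
apply: (cmp_all (p := fun k e => eval_code (a e) (b e) (d e) k == heis_rank 1%g)).
  exact: cmp_code_tail.
apply: cmp_eq (cmp_const _).
apply: (cmp_foldl (step := fun r l e => eval_step (a (fun i => e i.+1))
  (b (fun i => e i.+1)) (d (fun i => e i.+1)) r l)).
- exact: cmp_const.
- exact: cmp_var.
by apply: cmp_eval_step; do ?[exact: cmp_var]; apply: cmp_shift2 (cmp_shift1 _).
Qed.

Lemma cmp_cup_code c a b : cmp c -> cmp a -> cmp b ->
  cmp (fun e => cup_code (c e) (a e) (b e)).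
Proof.
move=> cc ca cb; apply: (cmp_exists (p := fun k e => kills_code (c e) (a e) (b e) k)).
  exact/cmp_expr2/cmp_code_head.
by apply: cmp_kills_code; [exact: cmp_shift1..|exact: cmp_var].
Qed.

Lemma cmp_reliso_code : cmp (fun e => reliso_code (e 0) (e 1)).
Proof.
rewrite /reliso_code /morph_code /add_code.
by repeat first
  [ apply: cmp_var | apply: cmp_cup_code | apply: cmp_exists | apply: cmp_forall
  | apply: cmp_eqb | apply: cmp_eq | apply: cmp_addb | apply: cmp_and
  | apply: cmp_imp | apply: cmp_bit | apply: cmp_digit | apply: cmp_expr2
  | apply: cmp_code_head | apply: cmpX ].
Qed.

End Computable.
End Decision.

(** * Correctness of the decision procedure *)

Section Correctness.
Variable K : finFieldType.
Hypothesis K2 : #|K| = 2.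

Definition bits_vec (n a : nat) : {ffun 'I_n -> K} := [ffun i : 'I_n => bitr K a i].

Definition relator_of (P : finpres) : word 'I_(ngens P) -> Prop :=
  fun w => w \in relators P.

Lemma bits_vec_inj n a b :
  a < 2 ^ n -> b < 2 ^ n -> bits_vec n a = bits_vec n b -> a = b.
Proof.
move=> lta ltb /ffunP ab; apply: bits_inj lta ltb _ => i ltin.
have := ab (Ordinal ltin); rewrite !ffunE /bitr /=.
by case: (bit a i) (bit b i) => [] [] // /eqP; rewrite ?oner_eq0 // eq_sym oner_eq0.
Qed.

Lemma bits_vec_exists (p : nat -> K) n :
  exists2 a, a < 2 ^ n & forall i, i < n -> bitr K a i = p i.
Proof.
have [a lta aE] := bits_exist n (fun i => p i != 0%R); exists a => // i /aE E.
by rewrite /bitr E; have [->|/(K_neq0 K2)->] := eqVneq (p i) 0%R.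
Qed.

Lemma bits_vec_surj n :
  exists m : {ffun 'I_n -> K} -> nat,
    (forall x, m x < 2 ^ n) /\ forall x, bits_vec n (m x) = x.
Proof.
suff /choice[m mP] : forall x : {ffun 'I_n -> K}, exists a, a < 2 ^ n /\ bits_vec n a = x.
  by exists m; split=> x; have [] := mP x.
move=> x; pose p i := if insub i is Some j then x j else 0%R.
have [a lta aE] := bits_vec_exists p n; exists a; split=> //.
by apply/ffunP => i; rewrite ffunE aE // /p valK.
Qed.

Lemma eval_codeE n (w : word 'I_n) a b d :
  eval_code K a b d (word_code w) =
  heis_rank (evalw (triple (fun i : 'I_n => bitr K a i) (fun i => bitr K b i)
                      (fun i => bitr K d i)) w).
Proof.
rewrite /eval_code /word_code CodeSeq.codeK /evalw; move: 1%g => g.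
elim: w g => //= -[i s] w IHw g; rewrite -IHw; congr foldl.
by rewrite /eval_step heis_rankK half_bit_double oddD odd_double addbF oddb.
Qed.

Lemma kills_codeP P a b d :
  reflect (kills (relator_of (P := P)) (triple (fun i : 'I_(ngens P) => bitr K a i)
             (fun i => bitr K b i) (fun i => bitr K d i)))
    (kills_code K (pres_code P) a b d).
Proof.
rewrite /kills_code code_tail_cons CodeSeq.codeK all_map.
apply: (iffP allP) => abd r /abd /=; rewrite eval_codeE.
  by move/eqP/(can_inj (@heis_rankK K)).
by move=> ->.
Qed.

(** Over a field with two elements every candidate [c] is given by the bits of some number below
    [2 ^ ngens P], so the bounded search misses no lift. *)
Lemma cup_codeP P a b :
  reflect (cup (relator_of (P := P)) (bits_vec _ a) (bits_vec _ b))
    (cup_code K (pres_code P) a b).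
Proof.
have vecE c : (fun i : 'I_(ngens P) => bitr K c i) = bits_vec (ngens P) c.
  by apply/funext => i; rewrite ffunE.
apply: (iffP (exists_ltP _ _)) => [[d _ /kills_codeP]|[c abc]].
  by rewrite !vecE => abd; exists (bits_vec _ d).
rewrite /pres_code code_head_cons.
pose p i := if insub i is Some j then c j else 0%R.
have [d ltd dE] := bits_vec_exists p (ngens P); exists d => //; apply/kills_codeP.
rewrite !vecE; suff -> : bits_vec (ngens P) d = c :> (_ -> _) by [].
by apply/funext => i; rewrite ffunE dE // /p valK.
Qed.

Lemma morph_codeP P P' y z :
  let N := 2 ^ ngens P in let N' := 2 ^ ngens P' in
  reflect ((forall a, a < N -> cup_code K (pres_code P) a a ->
              digit N z (digit N' y a) = a) /\
           (forall a b, a < N -> b < N -> cup_code K (pres_code P) a b ->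
              cup_code K (pres_code P') (digit N' y a) (digit N' y b)))
    (morph_code K (pres_code P) (pres_code P') y z).
Proof.
move=> N N'; rewrite /morph_code !code_head_cons -/N -/N'.
apply: (iffP (forall_ltP _ _)) => [H|[H1 H2] a lta].
  split=> [a lta aa|a b lta ltb].
    by have /andP[/implyP/(_ aa)/eqP] := H a lta.
  by have /andP[_ /forall_ltP/(_ b ltb)/implyP] := H a lta.
apply/andP; split; first by apply/implyP => /(H1 _ lta)->.
by apply/forall_ltP => b ltb; apply/implyP/H2.
Qed.

Lemma bitr_add a b c i :
  (bitr K c i = bitr K a i + bitr K b i)%R <-> bit c i = bit a i (+) bit b i.
Proof.
rewrite /bitr; split; last first.
  move=> ->; case: (bit a i) (bit b i) => [] [];
  by rewrite /= ?(K_addrr K2) ?addr0 ?add0r.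
case: (bit c i) (bit a i) (bit b i) => [] [] [] //= /eqP;
by rewrite ?(K_addrr K2) ?addr0 ?add0r ?oner_eq0 // eq_sym oner_eq0.
Qed.

Lemma bits_vec_add n a b c :
  (bits_vec n c = bits_vec n a + bits_vec n b)%R <->
  forall i, i < n -> bit c i == bit a i (+) bit b i.
Proof.
split=> [/ffunP E i ltin|E].
  by apply/eqP/bitr_add; have := E (Ordinal ltin); rewrite !ffunE.
by apply/ffunP => i; rewrite !ffunE; apply/bitr_add/eqP/E.
Qed.

Lemma add_codeP P P' y :
  let N := 2 ^ ngens P in let N' := 2 ^ ngens P' in
  reflect (forall a b s, a < N -> b < N -> s < N ->
      cup_code K (pres_code P) a a -> cup_code K (pres_code P) b b ->
      (bits_vec (ngens P) s = bits_vec _ a + bits_vec _ b)%R ->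
      (bits_vec (ngens P') (digit N' y s) =
        bits_vec _ (digit N' y a) + bits_vec _ (digit N' y b))%R)
    (add_code K (pres_code P) (pres_code P') y).
Proof.
move=> N N'; rewrite /add_code !code_head_cons -/N -/N'.
apply: (iffP (forall_ltP _ _)) => [H a b s lta ltb lts aa bb /bits_vec_add E|H a lta].
  apply/bits_vec_add/forall_ltP.
  move/forall_ltP/(_ b ltb)/forall_ltP/(_ s lts)/implyP: (H a lta); apply.
  by rewrite aa bb; apply/forall_ltP.
apply/forall_ltP => b ltb; apply/forall_ltP => s lts; apply/implyP.
case/andP=> /andP[aa bb] /forall_ltP/bits_vec_add E.
by apply/forall_ltP/bits_vec_add; exact: H E.
Qed.

Lemma digit_lt n y i : digit (2 ^ n) y i < 2 ^ n.
Proof. by rewrite ltn_mod expn_gt0. Qed.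

Lemma reliso_codeP P P' :
  reliso_code K (pres_code P) (pres_code P') <->
  reliso (@cup K _ (relator_of (P := P))) (@cup K _ (relator_of (P := P'))).
Proof.
have [m [m_lt mK]] := bits_vec_surj (ngens P).
have [m' [m'_lt m'K]] := bits_vec_surj (ngens P').
have Km a : a < 2 ^ ngens P -> m (bits_vec _ a) = a.
  by move=> lta; apply: bits_vec_inj => //; rewrite mK.
have Km' a : a < 2 ^ ngens P' -> m' (bits_vec _ a) = a.
  by move=> lta; apply: bits_vec_inj => //; rewrite m'K.
rewrite /reliso_code !code_head_cons.
split.
  case/exists_ltP=> y _ /exists_ltP[z _ /andP[/andP[/morph_codeP[yK yc] /morph_codeP[zK zc]]]].
  move=> /add_codeP yD.
  exists (fun x => bits_vec _ (digit (2 ^ ngens P') y (m x))).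
  exists (fun x => bits_vec _ (digit (2 ^ ngens P) z (m' x))); split.
  - move=> x x' xx'; apply/cup_codeP/yc => //.
    by apply/cup_codeP; rewrite !mK.
  - move=> x x' xx'; apply/cup_codeP/zc => //.
    by apply/cup_codeP; rewrite !m'K.
  - move=> x xx; rewrite Km' ?digit_lt // yK ?mK //.
    by apply/cup_codeP; rewrite !mK.
  - move=> x xx; rewrite Km ?digit_lt // zK ?m'K //.
    by apply/cup_codeP; rewrite !m'K.
  - move=> x x' xx xx'; apply: yD => //; rewrite ?mK //.
      by apply/cup_codeP; rewrite !mK.
    by apply/cup_codeP; rewrite !mK.
move=> [f [g [fc gc fK gK fD]]].
(* [y] and [z] tabulate [f] and [g], with vectors replaced by their numbers under [m] and [m']. *)
have [y lty yE] := @digits_exist (2 ^ ngens P') (2 ^ ngens P)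
  (fun a => m' (f (bits_vec _ a))) (fun a _ => m'_lt _).
have [z ltz zE] := @digits_exist (2 ^ ngens P) (2 ^ ngens P')
  (fun a => m (g (bits_vec _ a))) (fun a _ => m_lt _).
apply/exists_ltP; exists y => //; apply/exists_ltP; exists z => //; apply/andP; split.
  apply/andP; split; apply/morph_codeP; split.
  - by move=> a lta /cup_codeP aa; rewrite yE // zE // m'K fK // Km.
  - move=> a b lta ltb /cup_codeP ab; apply/cup_codeP.
    by rewrite !yE // !m'K; exact: fc.
  - by move=> a lta /cup_codeP aa; rewrite zE // yE // mK gK // Km'.
  - move=> a b lta ltb /cup_codeP ab; apply/cup_codeP.
    by rewrite !zE // !mK; exact: gc.
apply/add_codeP => a b s lta ltb lts /cup_codeP aa /cup_codeP bb E.
by rewrite !yE // !m'K E fD.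
Qed.

End Correctness.

Theorem theorem8p4 :
  exists A : recfun 2, forall P P' : finpres,
    (exists D : sgraph, isomorphic (fpgroup P) (raag D)) ->
    (exists D' : sgraph, isomorphic (fpgroup P') (raag D')) ->
    exists b : bool,
      computes A [tuple pres_code P; pres_code P'] b /\
      (b <-> isomorphic (fpgroup P) (fpgroup P')).
Proof.
have F2 : #|'F_2| = 2 by rewrite card_Fp.
have [A AE] := @cmp_recfun2 (reliso_code 'F_2) (cmp_reliso_code 'F_2).
exists A => P P' [D PD] [D' PD']; exists (reliso_code 'F_2 (pres_code P) (pres_code P')).
split; first exact: AE.
split=> [/(reliso_codeP F2) PP'|PP']; last first.
  apply/(reliso_codeP F2); exact: isomorphic_reliso PP'.
(* The given isomorphisms carry the relation over to the two Artin groups, where it determines the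
   graphs. *)
have DD' : isomorphic (raag D) (raag D').
  apply: (reliso_raag F2); apply: reliso_trans (reliso_trans PP' _).
    exact: isomorphic_reliso (isomorphic_sym PD).
  exact: isomorphic_reliso PD'.
exact: isomorphic_trans PD (isomorphic_trans DD' (isomorphic_sym PD')).
Qed.
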